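(* Let $S$ be a strata-connected subset of the chambers of a hyperplane arrangement $\mathcal{H}=\{H_1,\dots,H_n\}$ in general position in $\mathbb{R}^d$. Then the edge boundary of $S$ in the chamber graph satisfies $$|\partial S|\ \ge\ \sum_{A\in\operatorname{supp}(S)}|b(A)| .$$
   Context: Arrangement: $\mathcal{H}$ is a finite set of affine hyperplanes in $\mathbb{R}^d$. Chambers are the connected components of $\mathbb{R}^d\setminus\bigcup_i H_i$. General position: the intersection of any $k\le d$ hyperplanes of $\mathcal{H}$ is an affine subspace of dimension $d-k$, and no $d+1$ hyperplanes have a common point. Chamber graph: vertices are the chambers; two chambers are adjacent iff they share a common facet (equivalently, are separated by exactly one hyperplane of $\mathcal{H}$). The edge boundary $\partial S$ is the set of edges of the chamber graph with exactly one endpoint in $S$. For a set $S$ of chambers, its thickening is $T_S:=\operatorname{int}\bigl(\overline{\bigcup_{C\in S}C}\bigr)$. For $A\subseteq[n]=\{1,\dots,n\}$ let $L_A:=\bigcap_{f\in A}H_f$ (with $L_\emptyset=\mathbb{R}^d$) and $T_S(A):=T_S\cap L_A$ (the stratum of $A$). The support is $\operatorname{supp}(S):=\{A\subseteq[n]\mid T_S(A)\ne\emptyset\}$. $S$ is strata-connected if for every $A\in\operatorname{supp}(S)$ the stratum $T_S(A)$ is connected. For a hyperplane $H_e$, let $H_e^+,H_e^-$ be the two open half-spaces it determines. For $A\in\operatorname{supp}(S)$ and $e\in[n]$, the hyperplane $H_e$ bounds the stratum $T_S(A)$ if $T_S(A)$ is contained entirely in one of $H_e^+$, $H_e^-$ and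 $H_e\cap\overline{T_S(A)}\cap L_A\ne\emptyset$. The set of all hyperplanes of $\mathcal{H}$ that bound $T_S(A)$ is denoted $b(A)$. *)

(* Defs.v *)
From HB Require Import structures.
From mathcomp Require Import all_boot all_order all_algebra.
From mathcomp Require Import finmap.
From mathcomp Require Import all_classical all_reals all_analysis.

Set Implicit Arguments.
Unset Strict Implicit.
Unset Printing Implicit Defensive.

Import Order.TTheory GRing.Theory Num.Theory.
Import numFieldNormedType.Exports.

Local Open Scope classical_set_scope.
Local Open Scope ring_scope.

Section AffineGeometry.
Variables (R : realType) (d : nat).
Implicit Types (F L P : set 'rV[R]_d) (m : nat).

(* The direction space is the row space of U; an affine subspace is nonempty. *)
Definition affine_subspace m L : Prop :=
  exists (x0 : 'rV[R]_d) (U : 'M[R]_d),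
    \rank U = m /\ L = [set x | (x - x0 <= U)%MS].

Definition affine_hull F : set 'rV[R]_d :=
  \bigcap_(L in [set L | (exists m, affine_subspace m L) /\ F `<=` L]) L.

Definition has_dim m F : Prop := affine_subspace m (affine_hull F).

(* Improper faces (the case a = 0) are allowed: they are empty or equal to P,
   hence never facets of a full-dimensional P. *)
Definition face P F : Prop :=
  exists (a : 'cV[R]_d) (c : R),
    (forall x, P x -> (x *m a) 0 0 <= c) /\
    F = P `&` [set x | (x *m a) 0 0 = c].

(* The dimension is d - 1, written without truncated subtraction. *)
Definition facet P F : Prop :=
  face P F /\ exists2 m, m.+1 = d & has_dim m F.

End AffineGeometry.

(* The i-th hyperplane is {x | x . normal i = offset i}. The indexing is not
   required to be injective here; [general_position] forces it to be. *)
Record arrangement (R : realType) (d n : nat) := Arrangement {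
  normal : 'I_n -> 'cV[R]_d;
  offset : 'I_n -> R;
  normal_neq0 : forall i, normal i != 0
}.

Section Arrangement.
Variables (R : realType) (d n : nat) (H : arrangement R d n).
Implicit Types (A : {set 'I_n}) (e i : 'I_n) (C D : set 'rV[R]_d).
Implicit Types (S : set (set 'rV[R]_d)) (E : set (set 'rV[R]_d)).

Definition hyperplane i : set 'rV[R]_d :=
  [set x | (x *m normal H i) 0 0 = offset H i].
Definition pos_halfspace i : set 'rV[R]_d :=
  [set x | offset H i < (x *m normal H i) 0 0].
Definition neg_halfspace i : set 'rV[R]_d :=
  [set x | (x *m normal H i) 0 0 < offset H i].

Definition flat A : set 'rV[R]_d := \bigcap_(f in [set` A]) hyperplane f.

Definition general_position : Prop :=
  (forall A, (#|A| <= d)%N -> affine_subspace (d - #|A|) (flat A)) /\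
  (forall A, #|A| = d.+1 -> flat A = set0).

Definition arr_complement : set 'rV[R]_d :=
  ~` \bigcup_(i in [set: 'I_n]) hyperplane i.

Definition chambers : set (set 'rV[R]_d) :=
  [set connected_component arr_complement x | x in arr_complement].

Definition adjacent C D : Prop :=
  C != D /\ exists F, facet (closure C) F /\ facet (closure D) F.

Definition chamber_edges : set (set (set 'rV[R]_d)) :=
  [set E | exists C D,
    [/\ chambers C, chambers D, adjacent C D & E = [set C; D]]].

(* Edges are unordered pairs [set C; D]. Chambers being finite in number, so is
   this set, and its cardinality is #|` fset_set (edge_boundary S)|; note that
   fset_set would send an infinite set to the empty one. *)
Definition edge_boundary S : set (set (set 'rV[R]_d)) :=
  [set E | chamber_edges E /\ exists C, E `&` S = [set C]].

Definition thickening S : set 'rV[R]_d := interior (closure (\bigcup_(C in S) C)).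

Definition stratum S A : set 'rV[R]_d := thickening S `&` flat A.

Definition supp S : {set {set 'I_n}} := [set A | `[< stratum S A !=set0 >]]%SET.

Definition strata_connected S : Prop :=
  forall A, A \in supp S -> connected (stratum S A).

Definition bounds S A e : Prop :=
  (stratum S A `<=` pos_halfspace e \/ stratum S A `<=` neg_halfspace e) /\
  hyperplane e `&` closure (stratum S A) `&` flat A !=set0.

Definition bounding S A : {set 'I_n} := [set e | `[< bounds S A e >]]%SET.

End Arrangement.

(* Main.v *)
Require Import Defs.
From HB Require Import structures.
From mathcomp Require Import all_boot all_order all_algebra.
From mathcomp Require Import finmap.
From mathcomp Require Import all_classical all_reals all_analysis.
From mathcomp Require Import ring.

Set Implicit Arguments.
Unset Strict Implicit.
Unset Printing Implicit Defensive.

Import Order.TTheory GRing.Theory Num.Theory.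
Import numFieldNormedType.Exports.

(** The proof turns the inequality into one about finite families of sets.
A chamber is recorded by the set of hyperplanes that have it on their positive
side, its sign vector; [V] is the set of all sign vectors that occur, and [X]
that of the chambers of [S]. In general position all sign patterns occur
around every point, so a point lies in the thickening of [S] exactly when the
whole cube of sign vectors around it lies in [X] ([thickeningP]). Hence [A]
belongs to the support of [S] iff [X] contains a full cube in the directions
[A], in other words iff [X] strongly shatters [A] ([supp_shattered]).

Two counting facts are used about a family [X] and the set [shattered X] of
all [A] that it strongly shatters. Always [#|shattered X| <= #|X|]
([shattered_le_card]). Moreover [#|X| <= #|shattered X|] when, for every [A],
the cubes of directions [A] in [X] are connected to each other through cubes
of one more direction ([card_le_shattered]). Both are proved by cutting [X] in
two along a coordinate. The connectivity condition on cubes is what the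
connectedness of the strata becomes ([strata_cube_connected]).

Fix a hyperplane [e] and a side [b] of it. Let [U b] be the members of [X] on
side [b] whose mirror image across [e] is in [V], and let [Y] be those whose
mirror image is in [X]; the members of [U b :\: Y] correspond to the edges of the
boundary that leave [S] across [e] from side [b]. If [e] bounds the stratum of
[A], and this stratum is on side [b], then [U b] strongly shatters [A], as is
seen near a point of [e] in the closure of the stratum, but [U (~~ b)] does
not, as the stratum would then reach the other side ([bounds_shattered]).
Every set shattered by [Y] is shattered by both [U b] and [U (~~ b)], and [Y]
inherits the connectivity condition. Therefore the number of such [A] is at most
[#|shattered (U b)| - #|shattered Y| <= #|U b| - #|Y|]
([card_shattered_exits]), and it remains to sum over [e] and [b]. *)

(** * Strong shattering in families of sign vectors *)

Section SignVectors.
Import mathcomp.boot.fintype mathcomp.boot.finset.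
Variable T : finType.
Implicit Types (v w u : {set T}) (A B : {set T}) (e f i : T) (b : bool).
Implicit Types (X Y V : {set {set T}}).

Definition flip e v : {set T} := [set i | (i \in v) (+) (i == e)].
Definition put b e v : {set T} := [set i | if i == e then b else i \in v].
Definition cube v A : {set {set T}} := [set w | w :\: A == v :\: A].

Lemma in_cubeP v A w :
  reflect (forall i, i \notin A -> (i \in w) = (i \in v)) (w \in cube v A).
Proof.
rewrite inE; apply: (iffP eqP) => [/setP E i iA|E].
  by have := E i; rewrite !inE iA.
by apply/setP => i; rewrite !inE; case: (boolP (i \in A)) => //= /E.
Qed.

Lemma cube_refl v A : v \in cube v A. Proof. by rewrite inE. Qed.

Lemma cube_sym v w A : (v \in cube w A) = (w \in cube v A).
Proof. by rewrite !inE eq_sym. Qed.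

Lemma flipK e : involutive (flip e).
Proof. by move=> v; apply/setP => i; rewrite !inE -addbA addbb addbF. Qed.

Lemma in_flip e v : (e \in flip e v) = (e \notin v).
Proof. by rewrite inE eqxx addbT. Qed.

Lemma flip_put b e v : (e \in v) = ~~ b -> flip e v = put b e v.
Proof.
move=> ev; apply/setP => i; rewrite !inE; case: eqP => [->|_].
  by rewrite ev; case: b {ev}.
by rewrite addbF.
Qed.

Lemma put_id b e v : (e \in v) = b -> put b e v = v.
Proof. by move=> ev; apply/setP => i; rewrite !inE; case: eqP => // ->. Qed.

Lemma flip_in_cube e v A : e \in A -> flip e v \in cube v A.
Proof.
move=> eA; apply/in_cubeP => i iA; rewrite inE.
by case: eqP => [ie|_]; [rewrite ie eA in iA | rewrite addbF].
Qed.

Lemma cubeS v A B : A \subset B -> cube v A \subset cube v B.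
Proof.
move=> /subsetP AB; apply/subsetP => w /in_cubeP wv; apply/in_cubeP => i iB.
by apply: wv; apply: contra iB; apply: AB.
Qed.

Lemma cube_sub v w A B : w \in cube v B -> A \subset B -> cube w A \subset cube v B.
Proof.
move=> /in_cubeP wv /subsetP AB; apply/subsetP => u /in_cubeP uw.
apply/in_cubeP => i iB; rewrite uw ?wv //.
by apply: contra iB; apply: AB.
Qed.

Lemma cube1 v e w : w \in cube v [set e] -> w = v \/ w = flip e v.
Proof.
move=> /in_cubeP wv; have [ewv|ewv] := boolP ((e \in w) == (e \in v)); [left|right];
  apply/setP => i; rewrite ?inE; have [->|ie] := eqVneq i e; rewrite ?addbF ?addbT;
  try (by apply: wv; rewrite inE); first exact/eqP.
by case: (e \in w) ewv; case: (e \in v).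
Qed.

(** * Cubes in a family and their connectivity *)

Definition half X e b := [set v in X | (e \in v) == b].
Definition facing X e b := [set v in half X e b | flip e v \in X].
Definition shattered X := [set A | [exists v, cube v A \subset X]].
(** [adj X A] is the adjacency of the cubes of directions [A] inside [X], through
cubes with one more direction. The cubes are given by any of their vertices; as
[e] may belong to [A], moving between vertices of one cube is also a step, so
that no quotient is needed. *)
Definition adj X A v w := [exists e, (w == flip e v) && (cube v (e |: A) \subset X)].
Definition cube_connected X := forall A v w,
  cube v A \subset X -> cube w A \subset X -> connect (adj X A) v w.

Lemma shatteredP X A : reflect (exists v, cube v A \subset X) (A \in shattered X).
Proof. by rewrite inE; exact: existsP. Qed.

Lemma shatteredS X Y : X \subset Y -> shattered X \subset shattered Y.
Proof.
move=> XY; apply/subsetP => A /shatteredP[v vX]; apply/shatteredP; exists v.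
exact: subset_trans vX XY.
Qed.

Lemma in_facing X e b v :
  (v \in facing X e b) = [&& v \in X, (e \in v) == b & flip e v \in X].
Proof. by rewrite inE [v \in half _ _ _]inE andbA. Qed.

Lemma facing_half X e b : facing X e b \subset half X e b.
Proof. by apply/subsetP => v; rewrite inE => /andP[]. Qed.

Lemma halfS X e b : half X e b \subset X.
Proof. by apply/subsetP => v; rewrite inE => /andP[]. Qed.

Lemma card_half X e : #|X| = (#|half X e true| + #|half X e false|)%N.
Proof.
rewrite -(cardsID [set v : {set T} | e \in v] X); congr (_ + _)%N; apply: eq_card => v;
  by rewrite !inE; case: (_ \in X); case: (e \in v).
Qed.

Lemma cube_half X e b v A :
  e \notin A -> cube v A \subset X -> (e \in v) = b -> cube v A \subset half X e b.
Proof.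
move=> eA /subsetP vX ev; apply/subsetP => w wv; rewrite inE vX //=.
by rewrite (in_cubeP _ _ _ wv e eA) ev.
Qed.

Lemma cube_half_notin X e b v A : cube v A \subset half X e b -> e \notin A.
Proof.
move=> /subsetP vX; apply/negP => eA.
have := vX _ (flip_in_cube v eA); have := vX _ (cube_refl v A).
rewrite inE => /andP[_ /eqP <-]; rewrite inE in_flip => /andP[_].
by case: (e \in v).
Qed.

Lemma shattered_half X e : [set A in shattered X | e \notin A] =
  shattered (half X e true) :|: shattered (half X e false).
Proof.
apply/setP => A; rewrite inE in_setU; apply/andP/orP.
  move=> [/shatteredP[v vX] eA].
  by case ev: (e \in v); [left|right]; apply/shatteredP; exists v; exact: cube_half.
by case=> /shatteredP[v vX]; split; rewrite ?(cube_half_notin vX) //;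
  apply/shatteredP; exists v; apply: subset_trans vX (halfS _ _ _).
Qed.

Lemma cube_facing X e b v A : e \notin A -> cube v (e |: A) \subset X ->
  cube (put b e v) A \subset facing X e b.
Proof.
move=> eA /subsetP vX; apply/subsetP => w /in_cubeP wv.
have ew : (e \in w) = b by rewrite wv // inE eqxx.
have wX u : u = w \/ u = flip e w -> u \in X.
  move=> uw; apply: vX; apply/in_cubeP => i; rewrite !inE negb_or => /andP[ie iA].
  have -> : (i \in u) = (i \in w).
    by case: uw => -> //; rewrite inE (negbTE ie) addbF.
  by rewrite wv // inE (negbTE ie).
rewrite /facing /half !inE ew eqxx andbT; apply/andP; split; apply: wX; by [left|right].
Qed.

Lemma facing_cube X e b v A : cube v A \subset facing X e b ->
  cube v (e |: A) \subset X.
Proof.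
move=> vY; have eA := cube_half_notin (subset_trans vY (facing_half _ _ _)).
move/subsetP: vY => vX.
have : v \in facing X e b by apply: vX; exact: cube_refl.
rewrite in_facing => /and3P[_ /eqP ev _].
apply/subsetP => w /in_cubeP wv.
have [/eqP ew|ew] := boolP ((e \in w) == b).
  suff /vX : w \in cube v A by rewrite in_facing => /and3P[].
  apply/in_cubeP => i iA; have [->|ie] := eqVneq i e; first by rewrite ew.
  by apply: wv; rewrite !inE negb_or ie.
suff /vX : flip e w \in cube v A by rewrite in_facing flipK => /and3P[].
apply/in_cubeP => i iA; have [->|ie] := eqVneq i e.
  by rewrite in_flip ev; case: (e \in w) b ew {ev vX} => -[].
by rewrite inE (negbTE ie) addbF; apply: wv; rewrite !inE negb_or ie.
Qed.

(** Projecting along [e] turns cubes with directions [e |: A] into cubes with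
directions [A] in the facing family, and a path of the former into a path of
the latter; a step that flips [e] itself becomes constant. *)
Lemma adj_facing X e b A v w : e \notin A ->
  connect (adj X (e |: A)) v w ->
  connect (adj (facing X e b) A) (put b e v) (put b e w).
Proof.
move=> eA /connectP[p]; elim: p v => [|u p IH] v /=.
  by move=> _ ->; exact: connect0.
move=> /andP[/existsP[f /andP[/eqP uv vX]] pth lst].
apply: connect_trans (IH _ pth lst); rewrite {IH pth lst} uv.
have [fe|fe] := eqVneq f e.
  apply: eq_connect0; apply/setP => i; rewrite !inE fe.
  by case: eqP => // _; rewrite addbF.
apply: connect1; apply/existsP; exists f; apply/andP; split.
  apply/eqP/setP => i; rewrite !inE; have [->|//] := eqVneq i e.
  by rewrite eq_sym (negbTE fe) addbF.
apply: cube_facing; first by rewrite !inE negb_or eq_sym fe.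
by rewrite setUCA.
Qed.

Lemma cube_connected_facing X e b : cube_connected X -> cube_connected (facing X e b).
Proof.
move=> cX A v w vY wY.
have [/subsetP vY' /subsetP wY'] := (vY, wY).
have := vY' _ (cube_refl v A); have := wY' _ (cube_refl w A).
rewrite !inE => /andP[/andP[_ /eqP ew] _] /andP[/andP[_ /eqP ev] _].
have eA : e \notin A.
  exact: cube_half_notin (subset_trans vY (facing_half _ _ _)).
rewrite -(put_id ev) -(put_id ew); apply: adj_facing => //.
by apply: cX; apply: facing_cube; eauto.
Qed.

(** The directions of a large cube in [X] can be flipped one at a time, and each
flip stays in that cube. *)
Lemma connect_cube X A B v w : A \subset B -> cube v B \subset X ->
  w \in cube v B -> connect (adj X A) v w.
Proof.
move=> AB vX; have [m] := ubnP #|[set i | (i \in v) (+) (i \in w)]|.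
elim: m w => // m IH w; rewrite ltnS => dm wv.
have [->|/eqP vw] := eqVneq w v; first exact: connect0.
have [e ew] : exists e, (e \in v) (+) (e \in w).
  apply/existsP; apply: contraT => /existsPn E; case: vw; apply/setP => i.
  by have := E i; case: (i \in v); case: (i \in w).
have eB : e \in B.
  by apply: contraTT ew => /(in_cubeP _ _ _ wv) ->; rewrite addbb.
have fv : flip e w \in cube v B.
  by apply: (subsetP (cube_sub wv (subxx B))); exact: flip_in_cube.
apply: (connect_trans (y := flip e w)); last first.
  apply: connect1; apply/existsP; exists e; rewrite flipK eqxx /=.
  by apply: subset_trans vX; apply: cube_sub fv _; rewrite subUset sub1set eB.
apply: IH fv; apply: leq_trans dm; apply: proper_card; rewrite properE.
apply/andP; split; last first.
  by apply/subsetPn; exists e; rewrite !inE // eqxx addbT addbN ew.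
apply/subsetP => i; rewrite !inE; have [->|_] := eqVneq i e; last by rewrite addbF.
by rewrite addbT addbN ew.
Qed.

Lemma adjS X Y A v w : X \subset Y -> connect (adj X A) v w -> connect (adj Y A) v w.
Proof.
move=> XY; apply: connect_sub => {}v {}w /existsP[e /andP[wv vX]].
apply: connect1; apply/existsP; exists e; rewrite wv.
exact: subset_trans vX XY.
Qed.

(** A path of cubes in [X] between two cubes of one half may leave that half,
but only across [e], through cubes with directions [e |: A]. These are
connected to each other in [X], so by [adj_facing] the excursion can be replaced
by a path that runs along [e] inside the half. *)
Lemma cube_connected_half X e b : cube_connected X -> cube_connected (half X e b).
Proof.
move=> cX A v w vX wX.
have eA := cube_half_notin vX.
have [/subsetP vX' /subsetP wX'] := (vX, wX).
have := vX' _ (cube_refl v A); have := wX' _ (cube_refl w A).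
rewrite !inE => /andP[_ /eqP ew] /andP[_ /eqP ev].
have YX := facing_half X e b.
have /connectP[p] := cX A v w (subset_trans vX (halfS _ _ _))
  (subset_trans wX (halfS _ _ _)).
(* While the path is outside of the half, only the cube through which it left is
   remembered. *)
pose inv u : Prop := if (e \in u) == b then connect (adj (half X e b) A) v u : Prop else
   exists2 u', connect (adj (half X e b) A) v (put b e u') &
     cube u' (e |: A) \subset X.
suff H : forall p u, inv u -> path (adj X A) u p -> inv (last u p).
  move=> pth lst; have := H p v; rewrite -lst /inv ev ew eqxx /=.
  by apply => //; exact: connect0.
elim=> [//|u' {}p IH] u iu /= /andP[/existsP[f /andP[/eqP uu' uX]] pth].
apply: IH pth; move: iu; rewrite uu' {uu' u'} /inv.
have [fe|fe] := eqVneq f e; last first.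
  have -> : (e \in flip f u) = (e \in u) by rewrite inE eq_sym (negbTE fe) addbF.
  case: eqP => // eu vu; apply: connect_trans vu (connect1 _).
  apply/existsP; exists f; rewrite eqxx /=; apply: cube_half => //.
  by rewrite !inE negb_or eq_sym fe.
rewrite fe in uX *; rewrite in_flip {f fe}.
case: eqP => eu; first have -> : (~~ (e \in u)) == b = false by rewrite eu; case: (b).
  by move=> vu; exists u; rewrite ?(put_id eu).
have eub : (e \in u) = ~~ b by move: eu; case: (e \in u); case: (b).
have -> : (~~ (e \in u)) == b by rewrite eub negbK.
case=> u' vu' u'X; apply: connect_trans vu' _; rewrite (flip_put eub).
by apply: adjS YX _; apply: adj_facing => //; apply: cX.
Qed.

Lemma card_shattered X e : #|shattered X| =
  (#|shattered (half X e true) :|: shattered (half X e false)| +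
   #|[set A in shattered X | e \in A]|)%N.
Proof.
rewrite -shattered_half addnC -(cardsID [set A : {set T} | e \in A]).
by congr (_ + _)%N; apply: eq_card => A; rewrite !inE // andbC.
Qed.

(** The base case of the inductions below: such a family is empty or a
singleton, and a singleton shatters only the empty set. *)
Lemma shattered_le1 X : {in X &, forall v w, v = w} -> #|shattered X| = #|X|.
Proof.
move=> X1; have [->|[v vX]] := set_0Vmem X.
  rewrite cards0; apply/eqP; rewrite cards_eq0 -subset0; apply/subsetP => A.
  move=> /shatteredP[v /subsetP/(_ _ (cube_refl v A))]; by rewrite inE.
have -> : X = [set v].
  by apply/setP => w; rewrite inE; apply/idP/eqP => [wX|->//]; exact: X1.
suff -> : shattered [set v] = [set set0] by rewrite !cards1.
apply/setP => A; rewrite [RHS]inE; apply/shatteredP/eqP => [[w /subsetP wX]|->].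
  apply/eqP; rewrite -subset0; apply/subsetP => e eA.
  have /set1P := wX _ (flip_in_cube w eA); have /set1P <- := wX _ (cube_refl w A).
  by move/setP/(_ e); rewrite in_flip; case: (e \in w).
exists v; apply/subsetP => w /in_cubeP wv; apply/set1P/setP => i.
by apply: wv; rewrite inE.
Qed.

Lemma half_proper X v w e b : v \in X -> w \in X -> e \in v -> e \notin w ->
  half X e b \proper X.
Proof.
move=> vX wX ev ew; rewrite properE halfS; apply/subsetPn.
by exists (if b then w else v); case: b; rewrite ?inE ?vX ?wX // ?ev ?(negbTE ew).
Qed.

(** As long as two members of [X] differ, some coordinate separates them and
cuts [X] into two proper halves. *)
Lemma split_ind (P : {set {set T}} -> Prop) :
  (forall X, {in X &, forall v w, v = w} -> P X) ->
  (forall X e, (forall b, P (half X e b)) -> P X) ->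
  forall X, P X.
Proof.
move=> P1 P2 X; have [m] := ubnP #|X|; elim: m X => // m IH X Xm.
have [/existsP[[e [v w]] /and4P[/= vX wX ev ew]]|/existsPn N] := boolP
  [exists t : T * ({set T} * {set T}),
   [&& t.2.1 \in X, t.2.2 \in X, t.1 \in t.2.1 & t.1 \notin t.2.2]].
  apply: (P2 X e) => b; apply: IH; rewrite ltnS in Xm; apply: leq_trans Xm.
  exact: proper_card (half_proper b vX wX ev ew).
apply: P1 => v w vX wX; apply/setP => e; apply/idP/idP => H; apply/negPn/negP => H'.
  by have := N (e, (v, w)); rewrite /= vX wX H H'.
by have := N (e, (w, v)); rewrite /= vX wX H H'.
Qed.

(** A set shattered by [X] that contains [e] gives, after removing [e], a set
shattered by both halves. Thus the sets counted twice in the union of the two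
shattered families pay for the shattered sets through [e]. *)
Lemma shattered_le_card X : (#|shattered X| <= #|X|)%N.
Proof.
elim/split_ind: X => [X /shattered_le1 -> //|X e IH].
rewrite (card_shattered X e) (card_half X e).
apply: leq_trans (leq_add (IH true) (IH false)); rewrite -[X in (_ <= X)%N]cardsUI leq_add2l.
rewrite -(card_in_imset (f := fun A => A :\ e) (D := mem [set A in shattered X | e \in A])).
  apply: subset_leq_card; apply/subsetP => B /imsetP[A]; rewrite inE => /andP[].
  move=> /shatteredP[v vX] eA -> {B}; have eA' : e \notin A :\ e by rewrite !inE eqxx.
  suff H b : A :\ e \in shattered (half X e b) by rewrite inE !H.
  apply/shatteredP; exists (put b e v).
  apply: subset_trans (cube_facing b eA' _) (facing_half _ _ _).
  by rewrite setD1K.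
by move=> A B; rewrite !inE => /andP[_ eA] /andP[_ eB] E; rewrite -(setD1K eA) E setD1K.
Qed.

(** A path of cubes from one half to the other has to flip [e] at some step, and
that step is witnessed by a cube with directions [e |: A]. *)
Lemma shattered_cross X e A : cube_connected X ->
  A \in shattered (half X e true) -> A \in shattered (half X e false) ->
  e |: A \in shattered X.
Proof.
move=> cX /shatteredP[v vX] /shatteredP[w wX].
have ev : (e \in v) by move/subsetP: vX => /(_ _ (cube_refl v A)); rewrite !inE => /andP[_ /eqP].
have ew : (e \notin w).
  by move/subsetP: wX => /(_ _ (cube_refl w A)); rewrite !inE => /andP[_ /eqP ->].
have /connectP[p] := cX A v w (subset_trans vX (halfS _ _ _))
  (subset_trans wX (halfS _ _ _)).
elim: p v ev {vX} => [|u p IH] v ev /=.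
  by move=> _ wv; rewrite wv ev in ew.
move=> /andP[/existsP[f /andP[/eqP uv vX]] pth lst].
have [fe|fe] := eqVneq f e; first by apply/shatteredP; exists v; rewrite -fe.
by apply: IH pth lst; rewrite uv inE ev eq_sym (negbTE fe).
Qed.

(** The converse of the count in [shattered_le_card]: by [shattered_cross] a set
shattered by both halves gives a shattered set through [e]. *)
Lemma card_le_shattered X : cube_connected X -> (#|X| <= #|shattered X|)%N.
Proof.
elim/split_ind: X => [X /shattered_le1 -> //|X e IH] cX.
rewrite (card_shattered X e) (card_half X e).
apply: leq_trans (leq_add (IH _ (cube_connected_half cX)) (IH _ (cube_connected_half cX))) _.
rewrite -[X in (X <= _)%N]cardsUI leq_add2l.
set I := _ :&: _; have IeA A : A \in I -> e \notin A.
  by rewrite in_setI => /andP[/shatteredP[v /cube_half_notin]].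
rewrite -(card_in_imset (f := fun A => e |: A) (D := mem I)).
  apply: subset_leq_card; apply/subsetP => B /imsetP[A]; rewrite in_setI => /andP[At Af] -> {B}.
  by rewrite inE shattered_cross // setU11.
by move=> A B /IeA eA /IeA eB E; rewrite -(setU1K eA) E setU1K.
Qed.

(** * The edges that leave a family across one coordinate *)

Definition exits X V e := [set v in X | (flip e v \in V) && (flip e v \notin X)].
Definition inner X V e b := [set v in half X e b | flip e v \in V].

Lemma in_inner X V e b v :
  (v \in inner X V e b) = [&& v \in X, (e \in v) == b & flip e v \in V].
Proof. by rewrite inE [v \in half _ _ _]inE andbA. Qed.

Lemma facing_inner X V e b : X \subset V -> facing X e b \subset inner X V e b.
Proof.
move=> /subsetP XV; apply/subsetP => v.
by rewrite in_facing in_inner => /and3P[-> -> /XV ->].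
Qed.

(** The exits on side [b] are the members of [U b] outside of [Y]. The bound
combines the two inequalities in opposite directions: [shattered_le_card] for
[U b], about which nothing is known, and [card_le_shattered] for [Y], which
inherits connectivity from [X]. *)
Lemma card_shattered_exits X V e b : X \subset V -> cube_connected X ->
  (#|shattered (inner X V e b) :\: shattered (inner X V e (~~ b))| <=
   #|half (exits X V e) e b|)%N.
Proof.
move=> XV cX; set U := inner X V e; set Y := facing X e b.
have YU : Y \subset U b by exact: facing_inner.
have -> : half (exits X V e) e b = U b :\: Y.
  apply/setP => v; rewrite inE [v \in exits _ _ _]inE in_setD in_facing in_inner.
  by case: (v \in X); case: (_ == b); case: (_ \in V); case: (flip e v \in X).
have sY : shattered Y \subset shattered (U b) :&: shattered (U (~~ b)).
  rewrite subsetI shatteredS //=; apply/subsetP => A /shatteredP[v vY].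
  have vX := facing_cube vY.
  have eA : e \notin A.
    exact: cube_half_notin (subset_trans vY (facing_half _ _ _)).
  apply/shatteredP; exists (put (~~ b) e v).
  exact: subset_trans (cube_facing (~~ b) eA vX) (facing_inner _ _ XV).
rewrite -(leq_add2l #|Y|) -[X in (_ <= #|pred_of_set X| + _)%N](setIidPr YU) cardsID.
apply: leq_trans (shattered_le_card (U b)).
rewrite -(cardsID (shattered (U (~~ b))) (shattered (U b))) leq_add2r.
apply: leq_trans (card_le_shattered (cube_connected_facing cX)) _.
exact: subset_leq_card.
Qed.

End SignVectors.

(** * Sign vectors of points *)

Local Open Scope classical_set_scope.
Local Open Scope ring_scope.

Lemma connected_locally_constant (T : topologicalType) (U : Type) (f : T -> U)
    (A : set T) : connected A ->
  (forall x, A x -> \forall y \near x, A y -> f y = f x) ->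
  forall x y, A x -> A y -> f x = f y.
Proof.
move=> /connectedP cA fA x y Ax Ay; apply: contrapT => fxy.
pose E b := [set z | A z /\ if b then f z <> f x else f z = f x].
apply: (cA E); split.
- by case; [exists y | exists x]; split => // /esym.
- apply/seteqP; split => z /=; last by case=> -[].
  by move=> Az; have [fz|fz] := pselect (f z = f x); [left|right].
split; apply/seteqP; split => z //=.
  move=> [cz [Az fz]]; have [w [[Aw fw] /(_ Aw) fwz]] := cz _ (fA z Az).
  by apply: fz; rewrite -fwz.
move=> [[Az fz] cz]; have [w [[Aw fw] /(_ Aw) fwz]] := cz _ (fA z Az).
by apply: fw; rewrite fwz.
Qed.

Section Arrangements.
Variables (R : realType) (d n : nat) (H : arrangement R d n).
Implicit Types (A B v w : {set 'I_n}) (e i : 'I_n) (x y z : 'rV[R]_d) (t : R).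

Definition slope e x : R := (x *m normal H e) 0 0.
Definition height e x : R := slope e x - offset H e.

Lemma slopeD e x y : slope e (x + y) = slope e x + slope e y.
Proof. by rewrite /slope mulmxDl mxE. Qed.

Lemma slopeZ e t x : slope e (t *: x) = t * slope e x.
Proof. by rewrite /slope -scalemxAl mxE. Qed.

Lemma height_mix e t x y :
  height e (x + t *: (y - x)) = (1 - t) * height e x + t * height e y.
Proof.
rewrite /height slopeD slopeZ slopeD -scaleN1r slopeZ; ring.
Qed.

Lemma heightD e x y : height e (x + y) = height e x + slope e y.
Proof. by rewrite /height slopeD addrAC. Qed.

Lemma slope_continuous e : continuous (slope e).
Proof.
have -> : slope e = fun y => \sum_j y 0 j * normal H e j 0.
  by apply/funext => y; rewrite /slope mxE.
elim: (index_enum _) => [|j r IH] x.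
  by under eq_fun do rewrite big_nil; exact: cst_continuous.
under eq_fun do rewrite big_cons.
apply: (@continuousD R R^o _ (fun y : 'rV[R]_d => y 0 j * normal H e j 0)).
  by apply: continuousM; [exact: coord_continuous | exact: cst_continuous].
exact: IH.
Qed.

Lemma height_continuous e : continuous (height e).
Proof.
by move=> x; apply: continuousB; [exact: slope_continuous | exact: cst_continuous].
Qed.

(** Forgetting the coordinates in [zeros x] makes [signs x] a partial sign vector;
its completions, which form [cube (signs x) (zeros x)], are the sign vectors of
the cells that accumulate at [x] ([cell_closureP]). *)
Definition zeros x : {set 'I_n} := [set e | height e x == 0]%SET.
Definition signs x : {set 'I_n} := [set e | 0 < height e x]%SET.
Definition cell v : set 'rV[R]_d := [set x | zeros x = finset.set0 /\ signs x = v].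

Lemma in_zeros e x : (e \in zeros x) = (height e x == 0).
Proof. by rewrite inE. Qed.

Lemma in_signs e x : (e \in signs x) = (0 < height e x).
Proof. by rewrite inE. Qed.

Lemma height_lt0 e x : (height e x < 0) = (e \notin zeros x) && (e \notin signs x).
Proof. by rewrite in_zeros in_signs; case: ltgtP. Qed.

(** The only coordinates of the sign vector that can change near [x] are those
of the hyperplanes through [x]. All local arguments below rest on this. *)
Lemma near_signs x : \forall y \near x,
  zeros y \subset zeros x /\ signs y \in cube (signs x) (zeros x).
Proof.
have hP e : \forall y \near x, 0 < height e x -> 0 < height e y.
  case: (boolP (0 < height e x)) => [h0|_]; last by near=> y.
  by near=> y => _; near: y; apply: (cvgr_gt _ (@height_continuous e x)).
have hN e : \forall y \near x, height e x < 0 -> height e y < 0.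
  case: (boolP (height e x < 0)) => [h0|_]; last by near=> y.
  by near=> y => _; near: y; apply: (cvgr_lt _ (@height_continuous e x)).
near=> y.
have hPy : forall e, 0 < height e x -> 0 < height e y.
  by near: y; exact: filter_forall.
have hNy : forall e, height e x < 0 -> height e y < 0.
  by near: y; exact: filter_forall.
split.
  apply/fintype.subsetP => e; rewrite !in_zeros; have := hNy e; have := hPy e.
  by case: (ltgtP (height e x) 0) => // _ hp hn;
    [have := hn isT|have := hp isT]; case: ltgtP.
apply/in_cubeP => e; rewrite in_zeros !in_signs; have := hNy e; have := hPy e.
by case: (ltgtP (height e x) 0) => // _ _ hn _;
  have := hn isT; case: ltgtP.
Unshelve. all: by end_near. Qed.

Lemma near_segment x y (B : set 'rV[R]_d) : nbhs x B ->
  exists t, [/\ 0 < t, t < 1 & B (x + t *: (y - x))].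
Proof.
move=> xB.
have cB : \forall t \near 0^'+, B (x + t *: (y - x)).
  have : x + t *: (y - x) @[t --> (0 : R)^'+] --> x.
    apply: cvg_at_right_filter.
    rewrite -[X in _ --> X]addr0 -[X in x + X](scale0r (y - x)).
    apply: cvgD; first exact: cvg_cst.
    by apply: cvgZl; exact: cvg_id.
  by apply.
near (0 : R)^'+ => t; exists t; split; near: t => //.
- exact: nbhs_right_gt.
- exact: nbhs_right_lt.
Unshelve. all: by end_near. Qed.

Lemma mix_gt0 (a b t : R) : 0 <= a -> 0 < b -> 0 < t -> t < 1 ->
  0 < (1 - t) * a + t * b.
Proof.
move=> a0 b0 t0 t1; apply: ltr_wpDl; last exact: mulr_gt0.
by apply: mulr_ge0 => //; rewrite subr_ge0 ltW.
Qed.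

Lemma mix_cell v x y t : v \in cube (signs x) (zeros x) -> cell v y ->
  0 < t -> t < 1 -> cell v (x + t *: (y - x)).
Proof.
move=> /in_cubeP vx [zy sy] t0 t1.
suff hN e : if e \in v then 0 < height e (x + t *: (y - x))
            else height e (x + t *: (y - x)) < 0.
  by split; apply/setP => e; rewrite ?in_zeros ?in_signs ?finset.in_set0;
     have := hN e; case: ifP => _; case: ltgtP.
have : e \notin zeros y by rewrite zy finset.in_set0.
have := vx e; rewrite -sy !in_zeros !in_signs height_mix.
case: (ltgtP (height e y) 0) => hy //= + _; last first.
  by move=> H0; apply: mix_gt0 => //; move: H0; case: ltgtP => // _ /(_ isT).
move=> H0; rewrite -oppr_gt0 opprD -!mulrN; apply: mix_gt0; rewrite ?oppr_gt0 //.
by rewrite oppr_ge0; move: H0; case: ltgtP => // _ /(_ isT).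
Qed.

Lemma cell_closureP v x : cell v !=set0 ->
  closure (cell v) x <-> v \in cube (signs x) (zeros x).
Proof.
move=> [y vy]; split=> [cx|vx B Bx].
  have [z [[_ <-] [_ //]]] := cx _ (near_signs x).
have [t [t0 t1 tB]] := near_segment y Bx.
by exists (x + t *: (y - x)); split => //; exact: mix_cell.
Qed.

Lemma cell_open v : open (cell v).
Proof.
rewrite openE => x [zx sx]; rewrite /interior; near=> y.
have [] : zeros y \subset zeros x /\ signs y \in cube (signs x) (zeros x).
  by near: y; exact: near_signs.
rewrite zx finset.subset0 => /eqP zy; rewrite inE !finset.setD0 sx => /eqP sy.
by split.
Unshelve. all: by end_near. Qed.

Lemma cell_inj v w x : cell v x -> cell w x -> v = w.
Proof. by move=> [_ <-] [_ <-]. Qed.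

Lemma cell_eq v w : cell v !=set0 -> cell v = cell w -> v = w.
Proof. by move=> [x vx] vw; apply: (cell_inj vx); rewrite -vw. Qed.

(** A cell is a union of segments issued from one of its points. *)
Lemma cell_connected v : connected (cell v).
Proof.
have [->|/set0P [x vx]] := eqVneq (cell v) set0; first exact: connected0.
pose seg y := [set x + t *: (y - x) | t in `[0, 1]%classic].
have -> : cell v = \bigcup_(y in cell v) seg y.
  apply/seteqP; split => [y vy|z [y vy [t]]].
    exists y => //; exists 1; first by rewrite /= in_itv /= ler01 lexx.
    by rewrite scale1r addrC subrK.
  rewrite /= in_itv /= => /andP[t0 t1] <-.
  move: t0 t1; rewrite !le_eqVlt => /orP[/eqP<- _|t0 /orP[/eqP->|t1]].
  - by rewrite scale0r addr0.
  - by rewrite scale1r addrC subrK.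
  - by apply: mix_cell => //; have [-> ->] := vx; exact: cube_refl.
apply: bigcup_connected.
  by exists x => y vy; exists 0; rewrite ?scale0r ?addr0 //= in_itv /= lexx ler01.
move=> y vy; apply: connected_continuous_connected; first exact: segment_connected.
apply: continuous_subspaceT => t; apply: cvgD; first exact: cvg_cst.
by apply: cvgZl; exact: cvg_id.
Qed.

Lemma arr_complementE x : arr_complement H x <-> zeros x = finset.set0.
Proof.
split=> [Hx|zx [e _ ex]].
  apply/setP => e; rewrite in_zeros finset.in_set0; apply/negbTE/negP => /eqP he.
  by apply: Hx; exists e => //; apply/eqP; rewrite -subr_eq0; exact/eqP.
have : e \in zeros x by rewrite in_zeros subr_eq0; exact/eqP.
by rewrite zx finset.in_set0.
Qed.

(** On the complement of the hyperplanes [signs] is locally constant, hence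
constant on each connected component. *)
Lemma chamber_cell x : arr_complement H x ->
  connected_component (arr_complement H) x = cell (signs x).
Proof.
move=> Hx; apply/seteqP; split; last first.
  apply: connected_component_max; last exact: cell_connected.
    by split => //; exact/arr_complementE.
  by move=> y [zy _]; apply/arr_complementE.
move=> y xy; split; first by apply/arr_complementE; exact: connected_component_sub xy.
apply: (connected_locally_constant (A := connected_component (arr_complement H) x)) => //.
- exact: component_connected.
- move=> z /connected_component_sub /arr_complementE zz; near=> w => _.
  have [_] : zeros w \subset zeros z /\ signs w \in cube (signs z) (zeros z).
    by near: w; exact: near_signs.
  by rewrite inE zz !finset.setD0 => /eqP.
- exact: connected_component_refl.
Unshelve. all: by end_near. Qed.

Lemma chambersP C : chambers H C <-> exists2 v, cell v !=set0 & C = cell v.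
Proof.
split=> [[x Hx <-]|[v [x vx] ->]].
  exists (signs x); last exact: chamber_cell.
  by exists x; split => //; exact/arr_complementE.
have [zx sx] := vx; have Hx : arr_complement H x by apply/arr_complementE.
by exists x => //; rewrite chamber_cell // sx.
Qed.

Definition realised : {set {set 'I_n}} := [set v | `[< cell v !=set0 >]]%SET.

Lemma realisedP v : reflect (cell v !=set0) (v \in realised).
Proof. by rewrite inE; exact: asboolP. Qed.

Lemma hyperplaneP e x : hyperplane H e x <-> e \in zeros x.
Proof. by rewrite in_zeros subr_eq0; split => [/eqP|/eqP]. Qed.

Lemma flatP A x : flat H A x <-> A \subset zeros x.
Proof.
split=> [Ax|/fintype.subsetP Ax e /= /Ax /hyperplaneP //].
by apply/fintype.subsetP => e /Ax /hyperplaneP.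
Qed.

Lemma flat1 e : flat H [set e]%SET = hyperplane H e.
Proof.
by apply/seteqP; split => y; rewrite flatP finset.sub1set => /hyperplaneP.
Qed.

(** * Consequences of general position *)

Hypothesis hgp : general_position H.

Lemma card_zeros x : (#|zeros x| <= d)%N.
Proof.
rewrite leqNgt; apply/negP => dz.
have : (0 < #|[set A : {set 'I_n} | (A \subset zeros x) && (#|A| == d.+1)]%SET|)%N.
  by rewrite cards_draws bin_gt0.
move=> /card_gt0P[A]; rewrite inE => /andP[Ax /eqP cA].
by have : flat H A x by [exact/flatP]; rewrite hgp.2.
Qed.

(** The hyperplanes through [x] have independent normals: the flat in which they
meet contains the translate of the kernel of their matrix [M] and has dimension
[d - #|zeros x|], so [M] has full column rank. *)
Lemma slope_surj x (s : 'I_n -> R) : exists y, {in zeros x, forall e, slope e y = s e}.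
Proof.
set B := zeros x.
pose M : 'M[R]_(d, #|B|) := \matrix_(i, j) normal H (enum_val j) i 0.
have ME z j : (z *m M) 0 j = slope (enum_val j) z.
  by rewrite /slope !mxE; apply: eq_bigr => i _; rewrite mxE.
have [x0 [U [rU flatE]]] := hgp.1 B (card_zeros x).
have x0B : flat H B x0 by rewrite flatE /= subrr sub0mx.
have kU : (kermx M <= U)%MS.
  apply/row_subP => i; set u := row i _.
  have uM : u *m M = 0 by apply/sub_kermxP; exact: row_sub.
  have : flat H B (x0 + u).
    apply/flatP/fintype.subsetP => e eB.
    have /flatP/fintype.subsetP/(_ e eB) := x0B; rewrite !in_zeros heightD.
    have := ME u (enum_rank_in eB e); rewrite enum_rankK_in // uM mxE => <-.
    by rewrite addr0.
  by rewrite flatE /= addrC addKr.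
have /row_fullP[C CM] : row_full M.
  rewrite /row_full eqn_leq rank_leq_col /=.
  have := mxrankS kU; rewrite mxrank_ker rU => /(leq_sub2l d).
  by rewrite !subKn ?rank_leq_row //; exact: card_zeros.
exists ((\row_j s (enum_val j)) *m C) => e eB.
by have := ME ((\row_j s (enum_val j)) *m C) (enum_rank_in eB e);
   rewrite -mulmxA CM mulmx1 mxE enum_rankK_in.
Qed.

(** Independent normals allow one to leave [x] in a direction [y] that has any
prescribed signs on the hyperplanes through [x]; a short step keeps the other
signs. *)
Lemma cube_realised x v : v \in cube (signs x) (zeros x) -> cell v !=set0.
Proof.
move=> /in_cubeP vx.
have [y ys] := slope_surj x (fun e => if e \in v then 1 else -1).
have [t [t0 _ [zt /in_cubeP st]]] := near_segment (x + y) (near_signs x).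
exists (x + t *: (x + y - x)); set z := x + _ in zt st *.
have hz e : e \in zeros x -> height e z = t * (if e \in v then 1 else -1).
  move=> ex; rewrite height_mix heightD -(ys e ex).
  by move: ex; rewrite in_zeros => /eqP ->; rewrite mulr0 !add0r.
split; apply/setP => e.
  rewrite finset.in_set0; apply/negbTE/negP => ez.
  have := hz _ (fintype.subsetP zt _ ez); move: ez; rewrite in_zeros => /eqP ->.
  by move=> /esym/eqP; rewrite mulf_eq0 gt_eqF //=; case: ifP; rewrite ?oppr_eq0 oner_eq0.
have [ex|ex] := boolP (e \in zeros x); last by rewrite st ?vx.
by rewrite in_signs hz // pmulr_rgt0 //; case: ifP => _; rewrite ?ltr01 // oppr_gt0 ltr10.
Qed.

Lemma cube_sub_realised x : cube (signs x) (zeros x) \subset realised.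
Proof. by apply/fintype.subsetP => v /cube_realised vx; exact/realisedP. Qed.

(** A convexity argument, by induction on the directions: the segment between
points with opposite signs at [e], on the same side of all other hyperplanes,
crosses [e] at a point whose remaining signs are unchanged. *)
Lemma cube_point v A : cube v A \subset realised ->
  exists2 x, zeros x = A & signs x \in cube v A.
Proof.
have [m] := ubnP #|A|; elim: m A v => // m IH A v; rewrite ltnS => Am vV.
have [A0|[e eA]] := set_0Vmem A.
  have /realisedP[x [zx sx]] := fintype.subsetP vV _ (cube_refl v A).
  by exists x; rewrite ?A0 // sx cube_refl.
have ind b : exists2 x, zeros x = (A :\ e)%SET & signs x \in cube (put b e v) (A :\ e)%SET.
  apply: IH; first by rewrite (cardsD1 e A) eA in Am.
  apply: fintype.subset_trans vV; apply: cube_sub; last exact: subD1set.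
  by apply/in_cubeP => i iA; rewrite inE; case: eqP => // ie; rewrite ie eA in iA.
have hx b x : zeros x = (A :\ e)%SET -> signs x \in cube (put b e v) (A :\ e)%SET ->
    if b then 0 < height e x else height e x < 0.
  move=> zx /in_cubeP/(_ e); have := height_lt0 e x; rewrite zx -in_signs.
  rewrite !inE !eqxx /= => -> /(_ isT) ->; by case: b.
have [[x zx sx] [y zy sy]] := (ind true, ind false).
have hxe := hx _ _ zx sx; have hye := hx _ _ zy sy.
have D0 : 0 < height e x - height e y by rewrite subr_gt0 (lt_trans hye).
(* The height over [e] vanishes at parameter [t] of the segment from [x] to [y]. *)
pose t := height e x / (height e x - height e y).
have t0 : 0 < t by exact: divr_gt0.
have t1 : t < 1 by rewrite ltr_pdivrMr // mul1r ltrDl oppr_gt0.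
have he f : (f \in A) = (height f (x + t *: (y - x)) == 0) /\
    (f \notin A -> (f \in v) = (0 < height f (x + t *: (y - x)))).
  rewrite height_mix; have [->|fe] := eqVneq f e.
    rewrite eA; split => //; apply/esym/eqP; rewrite /t; field; exact: lt0r_neq0.
  have fA : (f \in A) = (f \in (A :\ e)%SET) by rewrite !inE fe.
  rewrite fA; have := height_lt0 f x; have := height_lt0 f y.
  have := in_zeros f x; have := in_zeros f y; rewrite zx zy !in_signs.
  have [fA1 /esym/eqP-> /esym/eqP-> _ _|fA1 _ _ + +] := boolP (f \in (A :\ e)%SET).
    by rewrite !mulr0 addr0 eqxx; split.
  have fv b : (f \in put b e v) = (f \in v) by rewrite inE (negbTE fe).
  have /in_cubeP/(_ f fA1) := sx; have /in_cubeP/(_ f fA1) := sy.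
  rewrite !fv !in_signs => hyf hxf; rewrite hyf hxf.
  case: (f \in v) hyf hxf => /= hyf hxf hy0 hx0.
    have mix0 := mix_gt0 (ltW hxf) hyf t0 t1.
    by rewrite mix0 gt_eqF.
  have mix0 : 0 < (1 - t) * - height f x + t * - height f y.
    by apply: mix_gt0; rewrite ?oppr_ge0 ?oppr_gt0 ?hy0 ?hx0 // ltW ?hx0.
  rewrite !mulrN -opprD oppr_gt0 in mix0.
  by rewrite lt_eqF // ltNge ltW.
exists (x + t *: (y - x)).
  by apply/setP => f; rewrite in_zeros -(he f).1.
by apply/in_cubeP => f fA; rewrite in_signs -(he f).2.
Qed.

(** * Strata in terms of sign vectors *)

Section Chambers.
Variable S : set (set 'rV[R]_d).
Hypothesis hS : S `<=` chambers H.

Definition labels : {set {set 'I_n}} := [set v in realised | `[< S (cell v) >]]%SET.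

Lemma labelsP v : v \in labels <-> (cell v !=set0 /\ S (cell v)).
Proof.
rewrite inE; split=> [/andP[/realisedP ? /asboolP]//|[v0 Sv]].
by apply/andP; split; [exact/realisedP|exact/asboolP].
Qed.

Lemma labels_realised : labels \subset realised.
Proof. by apply/fintype.subsetP => v; rewrite inE => /andP[]. Qed.

(** By general position every sign vector of the cube around [x] belongs to an
open cell that accumulates at [x], so it must come from [S] if a neighbourhood
of [x] is to be covered by the closure. Conversely, each point near [x] lies in
the closure of a cell from that cube. *)
Lemma thickeningP x : thickening S x <-> cube (signs x) (zeros x) \subset labels.
Proof.
split=> [Tx|/fintype.subsetP xX].
  apply/fintype.subsetP => w wx; have w0 := cube_realised wx.
  have /(_ _ Tx)[z [wz cz]] := (cell_closureP x w0).2 wx.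
  have : nbhs z (cell w) by apply: open_nbhs_nbhs; split => //; exact: cell_open.
  move=> /cz[y [[C SC Cy] wy]]; apply/labelsP; split => //.
  have /chambersP[v _ Cv] := hS SC; rewrite Cv in SC Cy.
  by rewrite (cell_inj wy Cy).
rewrite /thickening /interior; near=> y.
have [_ yx] : zeros y \subset zeros x /\ signs y \in cube (signs x) (zeros x).
  by near: y; exact: near_signs.
have /labelsP[y0 Sy] := xX _ yx.
apply: (closureS (A := cell (signs y))); first by move=> z yz; exists (cell (signs y)).
by apply/(cell_closureP y y0); exact: cube_refl.
Unshelve. all: by end_near. Qed.

Lemma stratumP A x : stratum H S A x <->
  cube (signs x) (zeros x) \subset labels /\ A \subset zeros x.
Proof.
by split=> [[/thickeningP ? /flatP ?]|[? ?]]; [|split; [exact/thickeningP|exact/flatP]].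
Qed.

Lemma stratum_point v A : cube v A \subset labels ->
  exists2 x, stratum H S A x & signs x \in cube v A.
Proof.
move=> vX.
have [x zx sx] := cube_point (fintype.subset_trans vX labels_realised).
exists x => //; apply/stratumP; rewrite zx fintype.subxx; split => //.
by apply: fintype.subset_trans vX; exact: cube_sub.
Qed.

Lemma supp_shattered A : (A \in supp H S) = (A \in shattered labels).
Proof.
rewrite inE; apply/asboolP/shatteredP => [[x /stratumP[xX Ax]]|[v /stratum_point[x Tx _]]].
  by exists (signs x); apply: fintype.subset_trans xX; exact: cubeS.
by exists x.
Qed.

(** Whether the cube of a point of the stratum is connected to a given cube is
locally constant: the cubes of the points near [z] all lie in the cube around
[z], where [connect_cube] links them. As the stratum is connected, this does not
depend on the point. *)
Lemma strata_cube_connected : strata_connected H S -> cube_connected labels.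
Proof.
move=> hc A v w vX wX.
have As : A \in supp H S by rewrite supp_shattered; apply/shatteredP; exists v.
have [x Tx xv] := stratum_point vX; have [y Ty yw] := stratum_point wX.
have vx : connect (adj labels A) v (signs x) by exact: connect_cube vX xv.
have yw' : connect (adj labels A) (signs y) w.
  by apply: (connect_cube (B := A)) => //;
   [apply: fintype.subset_trans wX; exact: cube_sub | rewrite cube_sym].
apply: connect_trans yw'.
pose f z := connect (adj labels A) v (signs z).
rewrite -[connect _ _ _]/(f y) -(connected_locally_constant (hc A As) _ Tx Ty) //.
move=> z /stratumP[zX Az]; near=> u => _.
have [_ uz] : zeros u \subset zeros z /\ signs u \in cube (signs z) (zeros z).
  by near: u; exact: near_signs.
apply/idP/idP => vz; apply: connect_trans vz _.
  apply: (connect_cube Az); last by rewrite cube_sym.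
  by apply: fintype.subset_trans zX; exact: cube_sub.
exact: connect_cube zX uz.
Unshelve. all: by end_near. Qed.

(** Near a point [x] of [e] in the closure of the stratum there is a point [y] of
the stratum, and the cube of [y] consists of members of [X]; their mirror images
across [e] are sign vectors around [x], hence are realised. On the other hand a
cube on the other side of [e] would give a point of the stratum there. *)
Lemma bounds_shattered A e : bounds H S A e ->
  exists b, A \in shattered (inner labels realised e b) :\:
                  shattered (inner labels realised e (~~ b)).
Proof.
move=> [side [x [[/hyperplaneP ex cx] _]]].
have [b sideb] : exists b, forall y, stratum H S A y ->
    e \notin zeros y /\ (e \in signs y) = b.
  case: side => side; [exists true|exists false] => y /side;
    rewrite /pos_halfspace /neg_halfspace /= in_zeros in_signs /height;
    by rewrite subr_eq0 subr_gt0 /slope; case: ltgtP.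
exists b; rewrite finset.in_setD; apply/andP; split; last first.
  have [y [Ty [zyx yx]]] := cx _ (near_signs x).
  have [ey eb] := sideb y Ty; move/stratumP: Ty => [yX Ay].
  apply/shatteredP; exists (signs y); apply/fintype.subsetP => w wy.
  have wX : w \in labels.
    by apply: (fintype.subsetP yX); exact: (fintype.subsetP (cubeS _ Ay)).
  rewrite in_inner wX -eb /=; apply/andP; split.
    by move/in_cubeP: wy => -> //; apply: contra ey; exact: (fintype.subsetP Ay).
  apply: (fintype.subsetP (cube_sub_realised x)).
  have wx : w \in cube (signs x) (zeros x).
    by apply: (fintype.subsetP (cube_sub yx zyx)); exact: (fintype.subsetP (cubeS _ Ay)).
  by apply: (fintype.subsetP (cube_sub wx (fintype.subxx _))); exact: flip_in_cube.
apply/shatteredP => -[v /fintype.subsetP vX].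
have vX' : cube v A \subset labels.
  by apply/fintype.subsetP => w /vX; rewrite in_inner => /and3P[].
have [y Ty yv] := stratum_point vX'.
have [_ eb] := sideb y Ty; have := vX _ yv; rewrite in_inner eb => /and3P[_ + _].
by case: (b).
Qed.

End Chambers.

(** * Exits are edges of the chamber graph *)

Lemma hyperplane_affine e :
  exists2 m, m.+1 = d & affine_subspace m (hyperplane H e).
Proof.
have [m dm] : exists m, m.+1 = d.
  case: (d) (normal H e) (normal_neq0 H e) => [N /eqP[]|m]; last by exists m.
  by apply/colP => -[].
exists m => //; rewrite -flat1.
have -> : m = (d - #|[set e]%SET|)%N by rewrite cards1 -dm subn1.
by apply: hgp.1; rewrite cards1 -dm.
Qed.

(** The cells of [v] and [flip e v] have a common boundary point [x] that lies on
no hyperplane but [e] ([cube_point]). Moving a little from [x] towards any point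
[z] of [e] stays in the common face, so an affine subspace that contains this
face contains [z]. *)
Lemma hyperplane_affine_hull v e : v \in realised -> flip e v \in realised ->
  affine_hull (closure (cell v) `&` hyperplane H e) = hyperplane H e.
Proof.
move=> vV fV; apply/seteqP; split => [x Fx|z ze L [[m [l0 [U [_ LE]]]] FL]].
  apply: Fx; split; last by move=> y [].
  by have [m _ He] := hyperplane_affine e; exists m.
have vV' : cube v [set e]%SET \subset realised.
  by apply/fintype.subsetP => w /cube1[]->.
have /realisedP v0 := vV.
have inL y : zeros y = [set e]%SET -> signs y \in cube v [set e]%SET -> (y - l0 <= U)%MS.
  move=> zy sy; have : L y; last by rewrite LE.
  apply: FL; split; last by apply/hyperplaneP; rewrite zy inE.
  by apply/cell_closureP => //; rewrite zy cube_sym.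
have [x zx sx] := cube_point vV'.
have [t [t0 t1 [zt st]]] := near_segment z (near_signs x).
set p := x + _ in zt st.
have pe : e \in zeros p.
  have /hyperplaneP := ze; rewrite !in_zeros height_mix => /eqP ->.
  have : e \in zeros x by rewrite zx inE.
  by rewrite in_zeros => /eqP ->; rewrite !mulr0 addr0.
have zp : zeros p = [set e]%SET.
  by apply/eqP; rewrite finset.eqEsubset finset.sub1set pe andbT -zx.
have Lx := inL _ zx sx; have Lp : (p - l0 <= U)%MS.
  by apply: inL => //; rewrite zx in st; apply: (fintype.subsetP (cube_sub sx _)) st.
rewrite LE /=; have -> : z - l0 = (x - l0) + t^-1 *: ((p - l0) - (x - l0)).
  have -> : (p - l0) - (x - l0) = t *: (z - x).
    by rewrite opprB addrA subrK /p addrC addKr.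
  by rewrite scalerA mulVf ?gt_eqF // scale1r [RHS]addrC addrA subrK.
apply: addmx_sub => //; apply: scalemx_sub; apply: addmx_sub => //.
by rewrite eqmx_opp.
Qed.

Lemma facet_cell v e : v \in realised -> flip e v \in realised ->
  facet (closure (cell v)) (closure (cell v) `&` hyperplane H e).
Proof.
move=> vV fV; have /realisedP v0 := vV; split.
  have clos x : closure (cell v) x ->
      if e \in v then offset H e <= slope e x else slope e x <= offset H e.
    move=> /(cell_closureP x v0)/in_cubeP/(_ e).
    rewrite in_zeros in_signs /height subr_gt0 subr_eq0.
    by case: (ltgtP (slope e x) (offset H e)) => // h; [move=> ->|move=> ->|case: ifP].
  have [ev|ev] := boolP (e \in v).
    have slopeN x : (x *m - normal H e) 0 0 = - slope e x by rewrite mulmxN mxE.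
    exists (- normal H e), (- offset H e); split => [x /clos|].
      by rewrite ev slopeN lerN2.
    apply/seteqP; split => x [cx xe]; split => //=; first by rewrite slopeN; congr (- _).
    by move: xe; rewrite /= slopeN => /oppr_inj.
  exists (normal H e), (offset H e); split => // x /clos.
  by rewrite (negbTE ev).
have [m dm He] := hyperplane_affine e.
by exists m => //; rewrite /has_dim hyperplane_affine_hull.
Qed.

Lemma closure_flip v e : v \in realised -> flip e v \in realised ->
  closure (cell v) `&` hyperplane H e `<=` closure (cell (flip e v)) `&` hyperplane H e.
Proof.
move=> /realisedP v0 /realisedP f0 x [/(cell_closureP x v0) vx xe]; split => //.
apply/(cell_closureP x f0).
apply: (fintype.subsetP (cube_sub vx (fintype.subxx _))).
by apply: flip_in_cube; apply/hyperplaneP.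
Qed.

Lemma cell_adjacent v e : v \in realised -> flip e v \in realised ->
  Defs.adjacent (cell v) (cell (flip e v)).
Proof.
move=> vV fV; split.
  apply/eqP => E; have /realisedP/cell_eq/(_ E)/setP/(_ e) := vV.
  by rewrite in_flip; case: (e \in v).
exists (closure (cell v) `&` hyperplane H e); split; first exact: facet_cell.
have -> : closure (cell v) `&` hyperplane H e =
          closure (cell (flip e v)) `&` hyperplane H e.
  apply/seteqP; split; first exact: closure_flip.
  by have := @closure_flip (flip e v) e; rewrite flipK; apply.
by apply: facet_cell; rewrite ?flipK.
Qed.

Lemma finite_edge_boundary (S : set (set 'rV[R]_d)) : finite_set (edge_boundary H S).
Proof.
apply: (@sub_finite_set _ _
  [set [set cell p.1; cell p.2] | p in [set: {set 'I_n} * {set 'I_n}]]); last first.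
  by apply: finite_image; exact: finite_finset.
move=> E [[C [D [/chambersP[v _ ->] /chambersP[w _ ->] _ ->]]] _].
by exists (v, w).
Qed.

(** * Counting the edge boundary *)

Section Chambers.
Variable S : set (set 'rV[R]_d).
Let X := labels S.

Definition exit_pairs : {set 'I_n * {set 'I_n}} :=
  [set p : 'I_n * {set 'I_n} | p.2 \in exits X realised p.1]%SET.
Definition exit_edge (p : 'I_n * {set 'I_n}) : set (set 'rV[R]_d) :=
  [set cell p.2; cell (flip p.1 p.2)].

Lemma exitsP v e : v \in exits X realised e ->
  [/\ v \in realised, flip e v \in realised, S (cell v) & ~ S (cell (flip e v))].
Proof.
rewrite inE => /and3P[/labelsP[v0 Sv] fV fX]; split => //; first exact/realisedP.
by move: fX => /negP + Sf; apply; apply/labelsP; split => //; exact/realisedP.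
Qed.

Lemma exit_edgeI p : p \in exit_pairs -> exit_edge p `&` S = [set cell p.2].
Proof.
rewrite inE => /exitsP[_ _ Sv Sf]; apply/seteqP; split => [C [[->|->] //]|C ->].
by split => //; left.
Qed.

Lemma exit_edge_boundary p : p \in exit_pairs -> edge_boundary H S (exit_edge p).
Proof.
move=> pD; split; last by exists (cell p.2); exact: exit_edgeI.
move: pD; rewrite inE => /exitsP[vV fV _ _].
exists (cell p.2), (cell (flip p.1 p.2)); split => //; last exact: cell_adjacent.
  by apply/chambersP; exists p.2 => //; exact/realisedP.
by apply/chambersP; exists (flip p.1 p.2) => //; exact/realisedP.
Qed.

(** The endpoint in [S] of an exit edge recovers [v], and the other endpoint then
recovers [e]. *)
Lemma exit_edge_inj : {in exit_pairs &, injective exit_edge}.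
Proof.
move=> [e v] [f w] eD fD E.
have : [set cell v] = [set cell w].
  by rewrite -(exit_edgeI eD) E (exit_edgeI fD).
move=> /seteqP[/(_ _ erefl) /= vw _].
have := eD; rewrite inE => /exitsP[/= /realisedP v0 /realisedP ev0 Sv Sev].
have {}vw := cell_eq v0 vw; subst w.
have : exit_edge (f, v) (cell (flip e v)) by rewrite -E; right.
move=> [/= ee|/= ee]; first by rewrite ee in Sev.
have /setP/(_ e) := cell_eq ev0 ee; rewrite in_flip inE.
by have [->//|_] := eqVneq e f; rewrite addbF; case: (e \in v).
Qed.

Lemma card_exit_pairs : (#|exit_pairs| <= #|` fset_set (edge_boundary H S)|)%N.
Proof.
have <- : #|` [fset exit_edge p | p in exit_pairs]%fset| = #|exit_pairs|.
  by rewrite card_in_imfset //= ?cardE //; exact: exit_edge_inj.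
apply: fsubset_leq_card; apply/fsubsetP => E /imfsetP[p /= pD ->].
by rewrite in_fset_set; [apply/mem_set/exit_edge_boundary | exact: finite_edge_boundary].
Qed.

End Chambers.
End Arrangements.

Theorem proposition3p5 (R : realType) (d n : nat) (H : arrangement R d n)
    (S : set (set 'rV[R]_d))
    (hgp : general_position H)
    (hS : S `<=` chambers H)
    (hconn : strata_connected H S) :
  (\sum_(A in supp H S) #|bounding H S A| <=
     #|` fset_set (edge_boundary H S)|)%N.
Proof.
apply: leq_trans (card_exit_pairs hgp S).
have cX := strata_cube_connected hgp hS hconn.
set X := labels H S in cX *; set V := realised H.
have XV : X \subset V by exact: labels_realised.
have -> : #|exit_pairs H S| = (\sum_e #|exits X V e|)%N.
  under [RHS]eq_bigr do rewrite -sum1_card.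
  rewrite pair_big_dep -sum1_card; apply: eq_bigl => p; by rewrite inE.
under eq_bigr do rewrite -sum1_card.
rewrite (exchange_big_dep xpredT) //=; apply: leq_sum => e _; rewrite sum1_card.
set U := fun b => shattered (inner X V e b) :\: shattered (inner X V e (~~ b)).
apply: (@leq_trans (#|U true| + #|U false|)%N).
  apply: leq_trans (leq_card_setU _ _); apply: subset_leq_card.
  apply/fintype.subsetP => A /andP[_]; rewrite inE => /asboolP.
  move=> /(bounds_shattered hgp hS)[[] AU]; apply/finset.setUP; by [left|right].
by rewrite [leqRHS](card_half _ e); apply: leq_add; exact: card_shattered_exits.
Qed.
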